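(* Let $f$ be a non-negative function from $\mathbb{N}_+$ to $[0,1]$, and let $\Lambda_f$ be the class of stationary memoryless sources on the alphabet $\mathbb{N}_+$ defined by the envelope $f$. Then, for every positive integer $n$, $$R^+(\Lambda_f^n)<\infty \iff R^*(\Lambda_f^n)<\infty .$$
   Context: Logarithms are in base 2; $\mathbb{N}_+=\{1,2,\dots\}$. A source on a countable alphabet $\mathcal{X}$ is a probability distribution $P$ on $\mathcal{X}^{\mathbb{N}}$; $P^n$ is the law of the first $n$ symbols and $\Lambda^n=\{P^n:P\in\Lambda\}$. A stationary memoryless source is one whose symbols are i.i.d. Throughout, only sources with finite Shannon entropy $H(X_{1:n})$ are considered. The envelope class $\Lambda_f$ is the collection of stationary memoryless sources $P$ on $\mathbb{N}_+$ with $P^1\{x\}\le f(x)$ for all $x\in\mathbb{N}_+$. $\mathfrak{M}_1(\mathcal{X}^n)$ is the set of probability distributions on $\mathcal{X}^n$, and $D(P^n,Q^n)=\sum_{\mathbf{x}}P^n(\mathbf{x})\log\frac{P^n(\mathbf{x})}{Q^n(\mathbf{x})}$. Minimax redundancy: $R^+(\Lambda^n)=\inf_{Q^n\in\mathfrak{M}_1(\mathcal{X}^n)}\sup_{P\in\Lambda}D(P^n,Q^n)$. Minimax regret: $R^*(\Lambda^n)=\inf_{Q^n\in\mathfrak{M}_1(\mathcal{X}^n)}\sup_{\mathbf{x}\in\mathcal{X}^n}\sup_{P\in\Lambda}\log\frac{P^n(\mathbf{x})}{Q^n(\mathbf{x})}$, with the conventions $0/0=0$, $\log0=-\infty$, $\log(a/0)=+\infty$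 for $a>0$. *)

(* Defs.v *)
From HB Require Import structures.
From mathcomp Require Import all_boot all_order all_algebra finmap.
From mathcomp Require Import all_classical all_reals all_analysis.
Set Implicit Arguments.
Unset Strict Implicit.
Unset Printing Implicit Defensive.
Import Order.TTheory GRing.Theory Num.Theory.
Local Open Scope classical_set_scope.
Local Open Scope ring_scope.
Local Open Scope ereal_scope.

Definition posnat := {k : nat | (0 < k)%N}.
HB.instance Definition _ := Countable.on posnat.
HB.instance Definition _ := isPointed.Build posnat (exist _ 1%N isT).

(* The library conventions on \bar R are exactly the ones needed below:
   0 / 0 = 0, a / 0 = +oo for a > 0, lne 0 = -oo, lne +oo = +oo and
   0 * -oo = 0 * +oo = 0. *)
Definition log2 {R : realType} (x : \bar R) : \bar R := lne x / (ln 2)%:E.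

Section sources.
(* X stands for a countable alphabet carrying its discrete sigma-algebra. *)
Context (R : realType) (X : pointedType).

Definition coordinate_event (i : nat) (A : set X) : set (nat -> X) :=
  [set w | A (w i)].

Definition coordinate_events : set (set (nat -> X)) :=
  [set coordinate_event i A | i in [set: nat] & A in [set: set X]].

(* Distributions on X^N, with the product sigma-algebra. *)
Definition source := probability (g_sigma_algebraType coordinate_events) R.

(* The law P^n of the first n symbols, as a mass function on X^n. *)
Definition law (P : source) (n : nat) (x : n.-tuple X) : \bar R :=
  P [set w : nat -> X | forall i : 'I_n, w i = tnth x i].

Definition identically_distributed (P : source) : Prop :=
  forall (i : nat) (A : set X),
    P (coordinate_event i A) = P (coordinate_event 0 A).

Definition independent_symbols (P : source) : Prop :=
  forall (J : {fset nat}) (A : nat -> set X),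
    P (\bigcap_(i in [set` J]) coordinate_event i (A i)) =
    \prod_(i <- J) P (coordinate_event i (A i)).

Definition stationary_memoryless (P : source) : Prop :=
  independent_symbols P /\ identically_distributed P.

Definition entropy (n : nat) (p : n.-tuple X -> \bar R) : \bar R :=
  \esum_(x in [set: n.-tuple X]) (- (p x * log2 (p x))).

Definition finite_entropy (P : source) : Prop :=
  forall n : nat, entropy (law P (n := n)) < +oo.

(* The set M_1(X^n), by mass functions. *)
Definition distributions (n : nat) : set (n.-tuple X -> \bar R) :=
  [set q | (forall x, 0 <= q x) /\ \esum_(x in [set: n.-tuple X]) q x = 1].

(* \esum is only meaningful for nonnegative terms, hence the split; for p and q
   in M_1(X^n) the negative part has a finite sum, so oo - oo never occurs. *)
Definition divergence (n : nat) (p q : n.-tuple X -> \bar R) : \bar R :=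
  let t := fun x => p x * log2 (p x / q x) in
  \esum_(x in [set: n.-tuple X]) t^\+ x - \esum_(x in [set: n.-tuple X]) t^\- x.

Definition minimax_redundancy (n : nat) (L : set source) : \bar R :=
  ereal_inf [set ereal_sup [set divergence (law P (n := n)) q | P in L]
            | q in @distributions n].

Definition minimax_regret (n : nat) (L : set source) : \bar R :=
  ereal_inf [set ereal_sup [set ereal_sup [set log2 (law P x / q x) | P in L]
                           | x in [set: n.-tuple X]]
            | q in @distributions n].

End sources.

Definition envelope_class (R : realType) (f : posnat -> R) :
    set (source R posnat) :=
  [set P | [/\ stationary_memoryless P, finite_entropy P &
               forall x : posnat, law P [tuple x] <= (f x)%:E]].

(* Main.v *)
From HB Require Import structures.
Require Import Defs.
From mathcomp Require Import all_boot all_order all_algebra finmap.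
From mathcomp Require Import all_classical all_reals all_analysis.
From mathcomp Require Import measurable_realfun ring lra.

(** Both quantities are finite when f is summable and infinite when it is not.
    The two implications have different reasons.

    Regret controls redundancy with the same coding distribution: if
    log (P(x) / q(x)) <= C for every x and every P in the class, then averaging
    over x gives D(P, q) <= C ([divergence_le]).

    Conversely, suppose first that f is summable.  Independence gives
    P(x_1, ..., x_n) <= f(x_1) ... f(x_n), so the normalised product of f
    dominates every source of the class up to the constant (sum f)^n.  To have
    something to normalise even when f = 0, the mass 1 is first added to f at
    one letter; the regret is then at most n log (1 + sum f) ([regret_lty]).

    If f is not summable the redundancy is infinite ([divergence_unbounded]).
    A distribution q on n-tuples has all but a small part of its mass on tuples
    that meet a fixed finite set G of letters ([distribution_tight]).
    Since sum f = +oo and f <= 1, there is a finite set of letters e outside G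
    with sum_e f >= 1 ([exists_heavy_seq]).  The memoryless source with
    marginal f / sum_e f on e stays below the envelope, lives on e^n, and
    q(e^n) <= 1/M forces D(P, q) >= log M ([divergence_ge], a consequence of
    ln y <= y - 1).  As M is arbitrary, no q has bounded divergence.

    The last step needs an actual probability on sequences with independent
    symbols of a prescribed finitely supported law.  It is built on the unit
    interval with Lebesgue measure: cut ]0, 1] into consecutive intervals of
    lengths p_0, p_1, ..., read off the index of the interval that contains u,
    blow this interval up affinely to ]0, 1], and repeat.  The blow-up map
    preserves Lebesgue measure and forgets the index just read, so the
    successive indices are independent ([digit_expand],
    [exists_memoryless_source]). *)

Set Implicit Arguments.
Unset Strict Implicit.
Unset Printing Implicit Defensive.
Import Order.TTheory GRing.Theory Num.Theory.
Local Open Scope classical_set_scope.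
Local Open Scope ring_scope.
Local Open Scope ereal_scope.

(** * Independent digits on the unit interval *)

(** Lebesgue measure is the only measure with the right value on intervals, and
    p^-1 times the image of Lebesgue measure by u |-> (u - c) / p has it. *)
Lemma lebesgue_measure_preimage_affine (R : realType) (c p : R) (E : set R) :
  (0 < p)%R -> measurable E ->
  lebesgue_measure [set u : R | E ((u - c) / p)%R] = p%:E * lebesgue_measure E.
Proof.
move=> p0 mE.
have mg : measurable_fun [set: measurableTypeR R]
    ((fun u => (u - c) / p)%R : measurableTypeR R -> measurableTypeR R).
  by apply: measurable_funM => //; exact: measurable_funB.
set g := (fun u => _) in mg.
have pV0 : (0 <= p^-1)%R by rewrite invr_ge0 ltW.
have [nu nuE] : exists nu : {measure set (measurableTypeR R) -> \bar R},
    forall A, nu A = lebesgue_measure (g @^-1` A).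
  by unshelve eexists
    (pushforward lebesgue_measure (g : _ -> measurableTypeR R)).
have -> : lebesgue_measure E = mscale (NngNum pV0) nu E.
  apply: lebesgue_measure_unique => // _ [[a b] _ <-].
  rewrite [RHS](_ : _ = p^-1%:E * lebesgue_measure (g @^-1` `]a, b])); last first.
    by rewrite -nuE.
  have -> : g @^-1` `]a, b] = `](p * a + c)%R, (p * b + c)%R]%classic.
    apply/seteqP; split => u /=;
    by rewrite /g !in_itv/= ltr_pdivlMr// ler_pdivrMr// ltrBrDr lerBlDr
      ![(p * _)%R]mulrC.
  rewrite !lebesgue_measure_itv/= !lte_fin ltrD2r ltr_pM2l//.
  case: ifPn => // _; last by rewrite mule0.
  by rewrite -!EFinD -EFinM; congr _%:E; field; rewrite gt_eqF.
by rewrite /mscale/= nuE muleA -EFinM divff ?mul1e ?gt_eqF.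
Qed.

Section iid_from_lebesgue.
Context (R : realType) (X : pointedType) (N : nat) (p : nat -> R) (a : nat -> X).
Hypothesis p_ge0 : forall k, (0 <= p k)%R.
Hypothesis p_sum1 : (\sum_(k < N) p k = 1)%R.

Let I : set R := `]0%R, 1%R]%classic.
Let mu := @lebesgue_measure R.

Definition cutoff k : R := (\sum_(i < k) p i)%R.

(** The intervals ]cutoff k, cutoff k.+1] for k < N tile ]0, 1]; [digit u] is the
    index of the one that contains u. *)
Definition digit u : nat := find (fun k => u <= cutoff k.+1)%R (iota 0 N).

(** The increasing affine bijection from ]cutoff k, cutoff k.+1] onto ]0, 1], when
    p k > 0; when p k = 0 the junk value 0 is outside ]0, 1], in agreement with
    the interval being empty. *)
Definition branch k u : R := ((u - cutoff k) / p k)%R.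

(** The expanding map: blow up the interval of u to ]0, 1].  The digits of u are
    read along its orbit. *)
Definition expand u : R := branch (digit u) u.

Let mI : measurable I. Proof. exact: measurable_itv. Qed.

Let muI : mu I = 1.
Proof. by rewrite /mu lebesgue_measure_itv/= lte_fin ltr01 oppr0 adde0. Qed.

Lemma cutoffS k : cutoff k.+1 = (cutoff k + p k)%R.
Proof. by rewrite /cutoff big_ord_recr. Qed.

Lemma cutoff_le : {homo cutoff : i j / (i <= j)%N >-> (i <= j)%R}.
Proof.
apply: homo_leq => [x//|y x z|k]; first exact: le_trans.
by rewrite cutoffS lerDl.
Qed.

Lemma digit_lt u : I u -> (digit u < N)%N.
Proof.
rewrite /I/= in_itv/= => /andP[u0 u1].
rewrite /digit -[X in (_ < X)%N](size_iota 0) -has_find; apply/hasP.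
have N0 : (0 < N)%N.
  case: (posnP N) p_sum1 => // -> /esym/eqP; by rewrite big_ord0 oner_eq0.
exists N.-1; first by rewrite mem_iota/= add0n ltn_predL.
by rewrite prednK// /cutoff p_sum1.
Qed.

Lemma branch_in k u : I (branch k u) <-> (cutoff k < u <= cutoff k.+1)%R.
Proof.
rewrite /I/= in_itv/= /branch cutoffS.
have := p_ge0 k; rewrite [(0 <= p k)%R]le_eqVlt => /predU1P[<-|pk].
  rewrite invr0 mulr0 ltxx addr0; split => // /andP[/lt_le_trans] /[apply].
  by rewrite ltxx.
by rewrite ltr_pdivlMr// mul0r ler_pdivrMr// mul1r subr_gt0 lerBlDl.
Qed.

Lemma digitE k u : I u -> (k < N)%N -> digit u = k <-> I (branch k u).
Proof.
move=> Iu kN; rewrite branch_in; have dN := digit_lt Iu.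
have hd : (u <= cutoff (digit u).+1)%R.
  have := nth_find 0%N (_ : has (fun k => u <= cutoff k.+1)%R (iota 0 N)).
  by rewrite has_find size_iota nth_iota// add0n; exact.
have ld j : (j < digit u)%N -> (cutoff j.+1 < u)%R.
  move=> jd; have := before_find 0%N jd.
  by rewrite nth_iota ?add0n; [move/negbT; rewrite -ltNge|exact: ltn_trans dN].
split=> [<-|/andP[ku uk]].
  rewrite hd andbT; case: (digit u) ld => [|d] ld; last exact: ld.
  by move: Iu; rewrite /I/= in_itv/= /cutoff big_ord0 => /andP[].
have [dk|kd|//] := ltngtP (digit u) k.
- by have := lt_le_trans ku (le_trans hd (cutoff_le dk)); rewrite ltxx.
- by have := lt_le_trans (ld _ kd) uk; rewrite ltxx.
Qed.

Lemma expand_in u : I u -> I (expand u).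
Proof. by move=> Iu; apply/digitE => //; exact: digit_lt. Qed.

Lemma branch_itv k u : (k < N)%N -> I (branch k u) -> I u.
Proof.
move=> kN /branch_in/andP[ku uk]; rewrite /I/= in_itv/=; apply/andP; split.
  by apply: le_lt_trans ku; apply: sumr_ge0.
by apply: le_trans uk _; rewrite -p_sum1; exact: cutoff_le.
Qed.

(** When p k = 0 the measure of the preimage is still p k times that of E, as no
    point is sent into ]0, 1]. *)
Lemma branch_preimage k E : measurable E -> E `<=` I ->
  measurable (branch k @^-1` E) /\ mu (branch k @^-1` E) = (p k)%:E * mu E.
Proof.
move=> mE EI; have := p_ge0 k; rewrite [(0 <= p k)%R]le_eqVlt => /predU1P[pk|pk].
  have -> : branch k @^-1` E = set0.
    rewrite -subset0 => u /EI/branch_in.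
    by rewrite cutoffS -pk addr0 => /andP[/lt_le_trans] /[apply]; rewrite ltxx.
  by rewrite -pk /mu measure0 mul0e; split.
split; last exact: lebesgue_measure_preimage_affine.
rewrite -[X in measurable X]setTI.
have : measurable_fun [set: R] (branch k).
  by apply: measurable_funM => //; exact: measurable_funB.
exact.
Qed.

(** The first digit is independent of the rest of the expansion: on the interval
    of index k the expanding map is affine with slope 1 / p k, so the points of
    this interval that are sent to E have measure p k * mu E. *)
Lemma digit_expand (A : set nat) E : measurable E -> E `<=` I ->
  measurable [set u | [/\ I u, A (digit u) & E (expand u)]] /\
  mu [set u | [/\ I u, A (digit u) & E (expand u)]] =
    (\sum_(k < N | nat_of_ord k \in A) p k)%:E * mu E.
Proof.
move=> mE EI.
pose F k := if k \in A then branch k @^-1` E else set0.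
have -> : [set u | [/\ I u, A (digit u) & E (expand u)]] =
    \big[setU/set0]_(k < N) F k.
  rewrite -bigcup_mkord; apply/seteqP; split => u /=.
    move=> [Iu Ad Es]; exists (digit u); first exact: digit_lt.
    by rewrite /F mem_set.
  move=> [k kN]; rewrite /F; case: ifPn => // /set_mem Ak Eu.
  have Iu : I u by apply: branch_itv kN _; exact: EI.
  have dk : digit u = k by apply/digitE => //; exact: EI.
  by split => //; rewrite /expand dk.
have mF k : measurable (F k).
  by rewrite /F; case: ifP => // _; case: (branch_preimage k mE EI).
split; first exact: bigsetU_measurable.
rewrite /mu measure_semi_additive_ord//; last 3 first.
- by move=> k; exact: mF.
- apply/trivIsetP => i j _ _ ij; rewrite -subset0 => u []; rewrite /F.
  case: ifP => // _ /EI Ii; case: ifP => // _ /EI Ij.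
  have Iu := branch_itv (ltn_ord i) Ii.
  have /digitE-/(_ Iu (ltn_ord i)) di := Ii.
  have /digitE-/(_ Iu (ltn_ord j)) dj := Ij.
  by move/eqP: ij; apply; apply/val_inj; rewrite /= -di -dj.
- by apply: bigsetU_measurable => k _; exact: mF.
rewrite -sumEFin ge0_sume_distrl; last by move=> *; rewrite lee_fin.
rewrite [RHS]big_mkcond/=; apply: eq_bigr => k _; rewrite /F.
by case: ifP => // _; case: (branch_preimage k mE EI).
Qed.

(** Iterates the independence of the first digit and the remainder. *)
Lemma cylinder_measure n (A : nat -> set nat) :
  measurable [set u | I u /\ forall i, (i < n)%N -> A i (digit (iter i expand u))]
  /\ mu [set u | I u /\ forall i, (i < n)%N -> A i (digit (iter i expand u))] =
    \prod_(i < n) (\sum_(k < N | nat_of_ord k \in A i) p k)%:E.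
Proof.
elim: n A => [|n IH] A.
  rewrite big_ord0 (_ : [set _ | _] = I) ?muI//.
  by apply/seteqP; split => u //= -[].
have [mC muC] := IH (fun i => A i.+1).
set C := [set _ | _] in mC muC.
have CI : C `<=` I by move=> u [].
have -> : [set u | I u /\ forall i, (i < n.+1)%N -> A i (digit (iter i expand u))]
    = [set u | [/\ I u, A 0%N (digit u) & C (expand u)]].
  apply/seteqP; split => u /=.
    move=> [Iu Au]; split => //; first exact: (Au 0%N).
    split; first exact: expand_in.
    by move=> i ni; rewrite -iterSr; exact: Au.
  move=> [Iu A0 [_ Cu]]; split => // -[//|i] ni.
  by rewrite iterSr; exact: Cu.
by have [mD muD] := digit_expand (A 0%N) mC CI; rewrite muD muC big_ord_recl.
Qed.

Definition symbols (u : R) : g_sigma_algebraType (@coordinate_events X) :=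
  fun i => a (digit (iter i expand u)).

Lemma measurable_symbols : measurable_fun (I : set (measurableTypeR R)) symbols.
Proof.
apply: (@measurability _ _ (measurableTypeR R) _ I symbols (@coordinate_events X))
  => // _ [_ [i _ [A _ <-]] <-].
have [mC _] := cylinder_measure i.+1
  (fun j => if j == i then a @^-1` A else setT).
rewrite (_ : _ `&` _ = [set u | I u /\ forall j, (j < i.+1)%N ->
  (if j == i then a @^-1` A else setT) (digit (iter j expand u))])//.
apply/seteqP; split => u [Iu Au]; split => //.
  by move=> j _; case: eqP => // ->.
by have := Au i (ltnSn i); rewrite eqxx.
Qed.

Let P (E : set (g_sigma_algebraType (@coordinate_events X))) : \bar R :=
  mu (I `&` symbols @^-1` E).

Let P0 : P set0 = 0.
Proof. by rewrite /P preimage_set0 setI0 /mu measure0. Qed.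

Let P_ge0 E : 0 <= P E.
Proof. exact: measure_ge0. Qed.

Let P_sigma_additive : semi_sigma_additive P.
Proof.
move=> F mF tF mUF; rewrite /P preimage_bigcup setI_bigcupr.
apply: measure_semi_sigma_additive.
- by move=> i; exact: measurable_symbols.
- apply/trivIsetP => i j _ _ ij; rewrite setIACA setIid -preimage_setI.
  by move/trivIsetP : tF => ->//; rewrite preimage_set0 setI0.
- by rewrite -setI_bigcupr -preimage_bigcup; exact: measurable_symbols.
Qed.

#[local] HB.instance Definition _ :=
  isMeasure.Build _ _ _ P P0 P_ge0 P_sigma_additive.

Let P_setT : P setT = 1.
Proof. by rewrite /P preimage_setT setIT muI. Qed.

#[local] HB.instance Definition _ :=
  Measure_isProbability.Build _ _ _ P P_setT.

(** The weights are indexed by positions k < N and not by letters, so that the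
    labels a k may repeat. *)
Lemma exists_iid_symbols : exists Q : source R X,
  forall n (A : nat -> set X),
    Q [set w | forall i, (i < n)%N -> A i (w i)] =
    \prod_(i < n) (\sum_(k < N | a k \in A i) p k)%:E.
Proof.
exists P => n A; have [_ muC] := cylinder_measure n (fun i => a @^-1` A i).
transitivity (\prod_(i < n)
  (\sum_(k < N | nat_of_ord k \in a @^-1` A i) p k)%:E).
  by rewrite -muC /P /=; congr lebesgue_measure; apply/seteqP; split.
apply: eq_bigr => i _; congr _%:E; exact: eq_bigl.
Qed.

End iid_from_lebesgue.

(** The digits are the positions in e.  As e has no repetition, a letter x of e
    has a single position, so its probability is g x. *)
Lemma exists_memoryless_source (R : realType) (X : pointedType) (e : seq X)
    (g : X -> R) :
  (forall x, (0 <= g x)%R) -> uniq e -> (forall x, x \notin e -> g x = 0%R) ->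
  (\sum_(x <- e) g x = 1)%R ->
  exists Q : source R X, stationary_memoryless Q /\
    forall n (x : n.-tuple X), law Q x = (\prod_(i < n) g (tnth x i))%:E.
Proof.
move=> g0 ue ge0 ge1; pose a := nth point e.
have [|Q QE] := @exists_iid_symbols R X (size e) (g \o a) a (fun k => g0 _).
  by rewrite -ge1 (big_nth point) big_mkord.
pose m (A : set X) := (\sum_(k < size e | a k \in A) g (a k))%R.
have mT : m setT = 1%R.
  rewrite /m (eq_bigl xpredT) => [|k]; last by rewrite in_setT.
  by rewrite -ge1 (big_nth point) big_mkord.
have QJ (J : {fset nat}) (A : nat -> set X) :
    Q (\bigcap_(i in [set` J]) coordinate_event i (A i)) =
    \prod_(i <- J) (m (A i))%:E.
  pose n := (\max_(i <- J) i).+1.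
  have Jn i : i \in J -> (i < n)%N by move=> iJ; rewrite ltnS; exact: leq_bigmax_seq.
  (* Free coordinates outside J turn J into an initial segment. *)
  pose A' i := if i \in J then A i else setT.
  rewrite (_ : \bigcap_(i in _) _ =
      [set w | forall i, (i < n)%N -> A' i (w i)]); last first.
    apply/seteqP; split=> w /= Aw i.
      by move=> _; rewrite /A'; case: ifPn => // iJ; exact: Aw.
    by move=> iJ; have := Aw i (Jn i iJ); rewrite /A' iJ.
  rewrite QE -(big_mkord xpredT (fun i => (m (A' i))%:E)).
  rewrite (eq_bigr (fun i => if i \in J then (m (A i))%:E else 1)); last first.
    by move=> i _; rewrite /A'; case: ifP => // _; rewrite mT.
  rewrite -big_mkcond -big_filter; apply: perm_big.
  apply: uniq_perm; rewrite ?filter_uniq ?iota_uniq ?fset_uniq// => i.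
  rewrite mem_filter mem_index_iota/=.
  by have [iJ|//] := boolP (i \in J); rewrite Jn.
have Qi i A : Q (coordinate_event i A) = (m A)%:E.
  have := QJ [fset i]%fset (fun _ => A).
  rewrite big_seq_fset1 => <-; congr (Q _); apply/seteqP; split=> w /=.
    by move=> Aw j /=; rewrite inE => /eqP ->.
  by move=> /(_ i); apply; rewrite /= inE.
exists Q; split.
  split=> [J A|i A]; last by rewrite !Qi.
  by rewrite QJ; apply: eq_bigr => i _; rewrite Qi.
move=> n x; rewrite /law (_ : [set _ | _] =
    [set w | forall i, (i < n)%N -> [set nth point x i] (w i)]); last first.
  apply/seteqP; split=> w /= wx i.
    by move=> ni; rewrite (wx (Ordinal ni)) (tnth_nth point).
  by rewrite (tnth_nth point); exact: wx.
rewrite (QE n (fun i => [set nth point x i])) -prodEFin.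
apply: eq_bigr => i _; congr _%:E; rewrite -(tnth_nth point).
have [xe|xe] := boolP (tnth x i \in e); last first.
  by rewrite ge0// big1// => k /set_mem/= ->; exact: ge0.
have ke : (index (tnth x i) e < size e)%N by rewrite index_mem.
rewrite (big_pred1 (Ordinal ke))/= ?/a ?nth_index// => k.
apply/idP/eqP => [/set_mem/= ak|->]; last by rewrite mem_set//= nth_index.
by apply/val_inj; rewrite /= -ak index_uniq.
Qed.

(** * Sums over tuples *)

Lemma esumZl (R : realType) (T : choiceType) (D : set T) (c : R)
    (h : T -> \bar R) :
  (0 <= c)%R -> (forall x, 0 <= h x) ->
  \esum_(x in D) (c%:E * h x) = c%:E * \esum_(x in D) h x.
Proof.
move=> c0 h0; rewrite /esum -ereal_supZl//; last first.
  by apply/set0P; exists (\sum_(x \in set0) h x), set0 => //; exact: fsets_set0.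
congr ereal_sup; apply/seteqP; split => [_ [A [fA AD] <-]|_ [_ [A AD <-] <-]].
  by exists (\sum_(x \in A) h x); [exists A|rewrite ge0_mule_fsumr].
by exists A => //; rewrite ge0_mule_fsumr.
Qed.

Lemma esum_tuple_prod (R : realType) (X : pointedType) (g : X -> R) (s : R) n :
  (forall x, (0 <= g x)%R) -> \esum_(x in [set: X]) (g x)%:E = s%:E ->
  \esum_(x in [set: n.-tuple X]) (\prod_(i < n) g (tnth x i))%:E = (s ^+ n)%:E.
Proof.
move=> g0 gs.
have s0 : (0 <= s)%R.
  by rewrite -lee_fin -gs; apply: esum_ge0 => x _; rewrite lee_fin.
elim: n => [|n IH].
  rewrite (_ : [set: _] = [set [tuple]]); last first.
    by apply/seteqP; split => // x _ /=; rewrite tuple0.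
  by rewrite esum_set1 big_ord0// lee_fin.
rewrite (reindex_esum ([set: X] `*`` (fun=> [set: n.-tuple X])) setT
  (fun z => cons_tuple z.1 z.2)); last first.
  split => //.
  - by move=> [x t] [y u] _ _ /(congr1 val)[-> /val_inj ->].
  - move=> x _; exists (thead x, behead_tuple x) => //=.
    by apply: val_inj; rewrite /= [RHS](congr1 val (tuple_eta x)).
have E (z : X * n.-tuple X) :
    (\prod_(i < n.+1) g (tnth (cons_tuple z.1 z.2) i))%:E =
    (g z.1)%:E * (\prod_(i < n) g (tnth z.2 i))%:E.
  rewrite big_ord_recl EFinM tnth0; congr (_ * (_)%:E).
  by apply: eq_bigr => i _; rewrite tnthS.
under eq_esum do rewrite E.
rewrite -(esum_esum (a := fun x t => (g x)%:E * (\prod_(i < n) g (tnth t i))%:E)).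
  rewrite (eq_esum (b := fun x => (s ^+ n)%:E * (g x)%:E)) => [|x _].
    by rewrite esumZl ?gs ?exprSr// exprn_ge0.
  rewrite esumZl//; last by move=> t; rewrite lee_fin prodr_ge0.
  by rewrite IH muleC.
by move=> x t _ _; rewrite mule_ge0// lee_fin// prodr_ge0.
Qed.

(** * Laws of the first symbols *)

Section law_facts.
Context (R : realType) (X : pointedType) (P : source R X).

Lemma measurable_coordinate_event i (A : set X) :
  measurable (coordinate_event i A : set (g_sigma_algebraType (@coordinate_events X))).
Proof. by apply: sub_sigma_algebra; exists i => //; exists A. Qed.

Lemma cylinderE n (x : n.-tuple X) :
  [set w : nat -> X | forall i : 'I_n, w i = tnth x i] =
  \bigcap_(i in [set` [fset i in iota 0 n]%fset])
    coordinate_event i [set nth point x i].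
Proof.
apply/seteqP; split => w /= wx i.
  move=> /=; rewrite !inE mem_iota/= add0n => ni.
  by rewrite /coordinate_event/= (wx (Ordinal ni)) (tnth_nth point).
rewrite (tnth_nth point); apply: wx => /=.
by rewrite !inE mem_iota/= add0n ltn_ord.
Qed.

Lemma measurable_cylinder n (x : n.-tuple X) :
  measurable ([set w : nat -> X | forall i : 'I_n, w i = tnth x i]
    : set (g_sigma_algebraType (@coordinate_events X))).
Proof.
rewrite cylinderE; apply: fin_bigcap_measurable => // i _.
exact: measurable_coordinate_event.
Qed.

Lemma law_ge0 n (x : n.-tuple X) : 0 <= law P x.
Proof. exact: measure_ge0. Qed.

Lemma law_fin_num n (x : n.-tuple X) : law P x \is a fin_num.
Proof. by apply: fin_num_measure; exact: measurable_cylinder. Qed.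

(** The summands are the values of P on disjoint cylinders; on an uncountable
    alphabet all these values may be zero. *)
Lemma esum_law_le1 n : \esum_(x in [set: n.-tuple X]) law P x <= 1.
Proof.
apply: ge_ereal_sup => _ [A [fA _] <-].
rewrite -measure_fin_bigcup//.
- apply: probability_le1; apply: fin_bigcup_measurable => // x _.
  exact: measurable_cylinder.
- apply/trivIsetP => x y _ _ /eqP xy; rewrite -subset0 => w /= [wx wy].
  by apply: xy; apply: eq_from_tnth => i; rewrite -wx -wy.
- by move=> x _; exact: measurable_cylinder.
Qed.

Lemma law_memoryless n (x : n.-tuple X) : stationary_memoryless P ->
  law P x = \prod_(i < n) law P [tuple tnth x i].
Proof.
move=> [ind idd]; rewrite /law cylinderE ind.
have E : perm_eq [fset i in iota 0 n]%fset (index_iota 0 n).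
  apply: uniq_perm; rewrite ?fset_uniq ?iota_uniq// => i.
  by rewrite !inE/= mem_index_iota mem_iota.
rewrite (perm_big _ E)/= big_mkord; apply: eq_bigr => i _.
rewrite idd; congr (P _); apply/seteqP; split => w /=.
  by rewrite /coordinate_event/= -(tnth_nth point) => wx j; rewrite (ord1 j).
by move=> /(_ ord0); rewrite /coordinate_event/= -(tnth_nth point).
Qed.

End law_facts.

(** * Bounds on the divergence *)

Section divergence_bounds.
Context (R : realType).

Lemma log2_div_le (K p q : R) : (0 < K)%R -> (0 <= p)%R -> (0 <= q)%R ->
  (p <= K * q)%R -> log2 (p%:E / q%:E) <= (ln K / ln 2)%:E.
Proof.
move=> K0 p0 q0 pKq; have ln20 : (0 < ln (2 : R))%R by rewrite ln_gt0// ltr1n.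
have [p00|pn0] := eqVneq p 0%R.
  rewrite p00 mul0e /log2 le0_lneNy// inver gt_eqF// gt0_mulNye ?leNye//.
  by rewrite lte_fin invr_gt0.
have pp : (0 < p)%R by rewrite lt0r pn0.
have qp : (0 < q)%R.
  rewrite lt0r q0 andbT; apply: contra_neq pn0 => q00.
  by apply/eqP; rewrite eq_le p0 andbT (le_trans pKq)// q00 mulr0.
rewrite /log2 !inver !gt_eqF// -EFinM lne_EFin ?divr_gt0// -EFinM lee_fin.
by rewrite ler_pM2r ?invr_gt0// ler_ln ?posrE ?divr_gt0// ler_pdivrMr.
Qed.

(** The inequality ln y <= y - 1 at y = M q / p.  It bounds a term of the
    divergence by an expression that is linear in p and q, hence summable. *)
Lemma mule_log2_div_ge (M p q : R) : (0 < M)%R -> (0 < p)%R -> (0 <= q)%R ->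
  ((p * (ln M + 1) / ln 2)%:E - (M * q / ln 2)%:E) <= p%:E * log2 (p%:E / q%:E).
Proof.
move=> M0 p0 q0; have ln20 : (0 < ln (2 : R))%R by rewrite ln_gt0// ltr1n.
have [->|qn0] := eqVneq q 0%R.
  rewrite /log2 !inver eqxx gt_eqF// gt0_muley//= gt0_mulye ?lte_fin ?invr_gt0//.
  by rewrite gt0_muley// leey.
have qp : (0 < q)%R by rewrite lt0r qn0.
rewrite /log2 !inver !gt_eqF// -EFinM lne_EFin ?divr_gt0// -!EFinM -EFinB lee_fin.
rewrite mulrA -mulrBl ler_pM2r ?invr_gt0//.
have : (ln (M * q / p) <= M * q / p - 1)%R.
  rewrite -{1}(subrKC 1 (M * q / p))%R; apply: le_ln1Dx.
  by rewrite ltrBrDr addNr divr_gt0// mulr_gt0.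
rewrite ln_div ?posrE ?mulr_gt0// lnM ?posrE// ln_div ?posrE// => h.
have : (p * (ln M + ln q - ln p) <= p * (M * q / p - 1))%R by rewrite ler_pM2l.
rewrite (_ : p * (M * q / p - 1) = M * q - p)%R; last by field; rewrite gt_eqF.
by lra.
Qed.

Context (X : pointedType).

(** Each term p log (p / q) is at most C p, and the p sum to at most 1; the
    negative part can only decrease the divergence. *)
Lemma divergence_le n (P : source R X) (q : n.-tuple X -> \bar R) (C : R) :
  (0 <= C)%R -> (forall x : n.-tuple X, log2 (law P x / q x) <= C%:E) ->
  divergence (law P (n := n)) q <= C%:E.
Proof.
move=> C0 PqC; rewrite /divergence.
set t := fun x : n.-tuple X => law P x * log2 (law P x / q x).
have tp : \esum_(x in [set: n.-tuple X]) t^\+ x <= C%:E.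
  apply: (@le_trans _ _ (\esum_(x in [set: n.-tuple X]) (C%:E * law P x))).
    apply: le_esum => x _; rewrite funeposE ge_max mule_ge0 ?law_ge0 ?lee_fin//.
    by rewrite andbT muleC; apply: lee_wpmul2l; [exact: law_ge0|exact: PqC].
  rewrite esumZl//.
  rewrite -[leRHS]mule1; apply: lee_wpmul2l; first by rewrite lee_fin.
  exact: esum_law_le1.
apply: le_trans tp; rewrite -[leRHS]sube0; apply: leeB => //.
exact: esum_ge0.
Qed.

(** Since p puts all its mass on a set S of q-mass at most 1 / M, the sum over S
    of the linear lower bounds (p (ln M + 1) - M q) / ln 2 is at least
    (ln M + 1 - 1) / ln 2. *)
Lemma divergence_ge n (p : n.-tuple X -> R) (q : n.-tuple X -> \bar R)
    (S : set (n.-tuple X)) (M : R) :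
  (forall x, (0 <= p x)%R) -> \esum_(x in [set: n.-tuple X]) (p x)%:E = 1 ->
  (forall x, ~ S x -> p x = 0%R) ->
  distributions q -> (1 <= M)%R -> \esum_(x in S) q x <= (M^-1)%:E ->
  (ln M / ln 2)%:E <= divergence (EFin \o p) q.
Proof.
move=> p0 p1 pS [q0 q1] M1 qS.
have ln20 : (0 < ln (2 : R))%R by rewrite ln_gt0// ltr1n.
have M0 : (0 < M)%R by exact: lt_le_trans M1.
have qfin x : q x \is a fin_num.
  rewrite ge0_fin_numE//; apply: (@le_lt_trans _ _ 1); last exact: ltry.
  rewrite -q1; apply: esum_ge; exists [set x] => //; last by rewrite fsbig_set1.
pose c := ((ln M + 1) / ln 2)%R.
have c0 : (0 <= c)%R.
  by rewrite divr_ge0 ?(ltW ln20)// addr_ge0// ln_ge0.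
pose d := (M / ln 2)%R.
have d0 : (0 <= d)%R by rewrite divr_ge0 ?(ltW ln20) ?(ltW M0).
(* F - G is the linear minorant of p log (p / q), extended by 0 outside S. *)
pose F x := c%:E * (p x)%:E.
pose G x := d%:E * (if x \in S then q x else 0).
have q0' x : 0 <= if x \in S then q x else 0 by case: ifP.
have F0 x : 0 <= F x by rewrite mule_ge0// lee_fin.
have G0 x : 0 <= G x by rewrite mule_ge0// lee_fin.
have sF : \esum_(x in setT) F x = c%:E.
  by rewrite /F esumZl ?p1 ?mule1// => x; rewrite lee_fin.
have sG : \esum_(x in setT) G x <= (ln 2)^-1%:E.
  rewrite /G esumZl// -esum_mkcond.
  apply: (@le_trans _ _ (d%:E * (M^-1)%:E)); first by apply: lee_wpmul2l.
  by rewrite -EFinM lee_fin /d mulrAC divff ?mul1r// gt_eqF.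
have FG : \esum_(x in setT) (F \- G)^\+ x - \esum_(x in setT) (F \- G)^\- x =
    \esum_(x in setT) F x - \esum_(x in setT) G x.
  apply: esumB => //; rewrite /summable.
  - under eq_esum do rewrite gee0_abs//. by rewrite sF ltry.
  - under eq_esum do rewrite gee0_abs//. by rewrite (le_lt_trans sG)// ltry.
have FGt x : F x - G x <= (EFin \o p) x * log2 ((EFin \o p) x / q x).
  rewrite /F /G /=; case: ifPn => [xS|xS]; last first.
    rewrite pS ?mule0 ?sube0 ?mul0e//.
    by move=> /mem_set; exact/negP.
  have [->|px0] := eqVneq (p x) 0%R.
    by rewrite mule0 mul0e sub0e oppe_le0 mule_ge0// lee_fin.
  have := @mule_log2_div_ge M (p x) (fine (q x)) M0 _ (fine_ge0 _).
  rewrite fineK// => /(_ _ (q0 _)); rewrite lt0r px0 p0 => /(_ isT).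
  apply: le_trans; rewrite -{1}(fineK (qfin x)) -!EFinM -!EFinB lee_fin.
  by rewrite /c /d; lra.
apply: (@le_trans _ _ (\esum_(x in setT) (F \- G)^\+ x -
                       \esum_(x in setT) (F \- G)^\- x)).
  rewrite FG sF.
  apply: (@le_trans _ _ (c%:E - (ln 2)^-1%:E)).
    rewrite -EFinB lee_fin /c; lra.
  by apply: leeB.
rewrite /divergence; apply: leeB; apply: le_esum => x _.
  by rewrite !funeposE ge_max !le_max lexx orbT andbT /= FGt.
by rewrite !funenegE ge_max !le_max lexx orbT andbT /= leeN2 FGt.
Qed.

End divergence_bounds.

(** * Sources with finite support *)

Lemma finite_entropy_of_support (R : realType) (X : pointedType)
    (P : source R X) (e : seq X) :
  (forall n (x : n.-tuple X), ~~ all [in e] x -> law P x = 0) ->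
  finite_entropy P.
Proof.
move=> Pe n; rewrite /entropy.
pose S := [set x : n.-tuple X | all [in e] x].
have fS : finite_set S.
  apply: (@sub_finite_set _ _ ((fun h : {ffun 'I_n -> 'I_(size e)} =>
    [tuple nth point e (h i) | i < n]) @` setT)); last exact: finite_image.
  move=> x /= /all_tnthP xe.
  have xi i : (index (tnth x i) e < size e)%N by rewrite index_mem xe.
  exists [ffun i => Ordinal (xi i)] => //.
  by apply: eq_from_tnth => i; rewrite tnth_mktuple ffunE nth_index// xe.
have ent (x : n.-tuple X) : 0 <= - (law P x * log2 (law P x)) < +oo.
  have [p pE p01] : exists2 p, law P x = p%:E & (0 <= p <= 1)%R.
    exists (fine (law P x)); first by rewrite fineK// law_fin_num.
    rewrite -!lee_fin fineK ?law_fin_num// law_ge0/=.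
    by apply: probability_le1; exact: measurable_cylinder.
  have /andP[p0 p1] := p01; rewrite pE.
  have [->|pn0] := eqVneq p 0%R; first by rewrite mul0e oppe0 lexx ltry.
  rewrite /log2 lne_EFin; last by rewrite lt0r pn0.
  rewrite inver gt_eqF ?ln_gt0 ?ltr1n// -!EFinM -EFinN ltry andbT lee_fin.
  rewrite -mulrN mulr_ge0// -mulNr divr_ge0 ?oppr_ge0 ?ln_le0//.
  by rewrite ln_ge0// ler1n.
rewrite (eq_esum (b := fun x : n.-tuple X =>
    if x \in S then - (law P x * log2 (law P x)) else 0)); last first.
  move=> x _; case: ifPn => // xS; rewrite Pe ?mul0e ?oppe0//.
  by apply: contra xS => xe; rewrite inE.
rewrite -esum_mkcond esum_fset//; last by move=> x _; case/andP: (ent x).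
rewrite fsbig_finite//; apply: lte_sum_pinfty => x _.
by case/andP: (ent x).
Qed.

(** * Summability of the envelope *)

(** A finite set of f-mass above #|G| + 1 keeps mass at least 1 after removal of
    G, because f <= 1. *)
Lemma exists_heavy_seq (R : realType) (X : choiceType) (f : X -> R) (G : seq X) :
  (forall x, (0 <= f x <= 1)%R) -> \esum_(x in [set: X]) (f x)%:E = +oo ->
  exists e : seq X, [/\ uniq e, {in e, forall x, x \notin G} &
    (1 <= \sum_(x <- e) f x)%R].
Proof.
move=> f01 foo.
have : ((size G).+1%:R)%:E < \esum_(x in [set: X]) (f x)%:E by rewrite foo ltry.
move=> /ereal_sup_gt[_ [A [fA _] <-]].
rewrite fsbig_finite//= sumEFin lte_fin => GA.
exists [seq x <- fset_set A | x \notin G]; split.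
- by rewrite filter_uniq.
- by move=> x; rewrite mem_filter => /andP[].
move: GA; rewrite (bigID [in G])/= big_filter -natr1.
suff : (\sum_(x <- fset_set A | x \in G) f x <= (size G)%:R)%R by lra.
apply: (@le_trans _ _ (\sum_(x <- fset_set A | x \in G) 1)%R).
  by apply: ler_sum => x _; case/andP: (f01 x).
rewrite -big_filter big_const_seq count_predT iter_addr_0 ler_nat.
apply: uniq_leq_size; first by rewrite filter_uniq.
by move=> x; rewrite mem_filter => /andP[].
Qed.

(** Take for G the letters of finitely many tuples that carry mass 1 - eps: a
    tuple without letter in G is none of these.  The case n = 0 is excluded
    because the empty tuple has no letter at all. *)
Lemma distribution_tight (R : realType) (X : pointedType) n
    (q : n.-tuple X -> \bar R) (eps : R) :
  (0 < n)%N -> distributions q -> (0 < eps)%R ->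
  exists G : seq X, forall S : set (n.-tuple X),
    (forall x, S x -> forall i, tnth x i \notin G) ->
    \esum_(x in S) q x <= eps%:E.
Proof.
move=> n0 [q0 q1] eps0.
have : (1 - eps)%:E < \esum_(x in [set: n.-tuple X]) q x.
  by rewrite q1 lte_fin ltrBlDr ltrDl.
move=> /ereal_sup_gt[_ [A [fA _] <-]] qA.
exists (flatten [seq tval x | x <- fset_set A]) => S SG.
have SA x : S x -> ~ A x.
  move=> Sx Ax; have /negP := SG x Sx (Ordinal n0); apply.
  apply/flattenP; exists (tval x); last exact: mem_tnth.
  by apply: map_f; rewrite in_fset_set// inE.
have SA' : \esum_(x in S) q x <= \esum_(x in ~` A) q x.
  rewrite esum_mkcond [leRHS]esum_mkcond; apply: le_esum => x _.
  case: ifPn => [xS|_]; last by case: ifP.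
  by rewrite ifT// inE; apply: SA; exact/set_mem.
apply: le_trans SA' _.
have := esumID A setT q (fun x _ => q0 x).
rewrite q1 !setTI esum_fset//.
case: (\esum_(x in _) q x) (esum_ge0 (S := ~` A) (fun x _ => q0 x)) => [r _||//].
  move: qA; case: (\sum_(x \in A) q x) => [s||]//.
  by rewrite lte_fin -EFinD lee_fin => sE [e1]; lra.
by move=> _; move: qA; case: (\sum_(x \in A) q x).
Qed.

Lemma esum_seq (R : realType) (X : choiceType) (e : seq X) (g : X -> R) :
  uniq e -> (forall x, (0 <= g x)%R) -> (forall x, x \notin e -> g x = 0%R) ->
  \esum_(x in [set: X]) (g x)%:E = (\sum_(x <- e) g x)%:E.
Proof.
move=> ue g0 ge0.
rewrite (eq_esum (b := fun x => if x \in [set` e] then (g x)%:E else 0)) => [|x _].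
  rewrite -esum_mkcond esum_fset//; last by move=> x _; rewrite lee_fin.
  by rewrite -fsbig_seq// sumEFin.
case: ifPn => // /negP xe; rewrite ge0//.
by apply/negP => xine; apply: xe; exact: mem_set.
Qed.

(** The witness is the memoryless source with marginal f / sum_e f on a finite
    set e of letters that q nearly ignores; sum_e f >= 1 keeps this marginal
    below the envelope, and finiteness of e makes all entropies finite. *)
Lemma divergence_unbounded (R : realType) (f : posnat -> R) n
    (q : n.-tuple posnat -> \bar R) (M : R) :
  (forall x, (0 <= f x <= 1)%R) -> \esum_(x in [set: posnat]) (f x)%:E = +oo ->
  (0 < n)%N -> distributions q -> (1 <= M)%R ->
  exists2 P, envelope_class f P &
    (ln M / ln 2)%:E <= divergence (law P (n := n)) q.
Proof.
move=> f01 foo n0 dq M1; have M0 : (0 < M)%R by exact: lt_le_trans M1.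
have f0 x : (0 <= f x)%R by case/andP: (f01 x).
have [|G qG] := @distribution_tight _ _ _ q M^-1 n0 dq; first by rewrite invr_gt0.
have [e [ue eG fe]] := exists_heavy_seq G f01 foo.
set s := (\sum_(x <- e) f x)%R in fe; have s0 : (0 < s)%R by exact: lt_le_trans fe.
pose g x := if x \in e then (f x / s)%R else 0%R.
have g0 x : (0 <= g x)%R by rewrite /g; case: ifP => // _; rewrite divr_ge0// ltW.
have ge0 x : x \notin e -> g x = 0%R by rewrite /g => /negbTE ->.
have ge1 : (\sum_(x <- e) g x = 1)%R.
  rewrite big_seq (eq_bigr (fun x => f x / s)%R) => [|x xe]; last by rewrite /g xe.
  by rewrite -big_seq -mulr_suml divff// gt_eqF.
have [P [Pmem lawP]] := exists_memoryless_source g0 ue ge0 ge1.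
have supp m (x : m.-tuple posnat) : ~~ all [in e] x ->
    (\prod_(i < m) g (tnth x i) = 0)%R.
  move=> /allPn[y /tnthP[i ->] xe].
  apply/eqP; rewrite prodf_seq_eq0; apply/hasP; exists i.
    by rewrite mem_index_enum.
  by rewrite /= ge0.
exists P.
  split=> //.
  - by apply: (finite_entropy_of_support (e := e)) => m x /supp xe; rewrite lawP xe.
  - move=> x; rewrite lawP lee_fin big_ord1 /g; case: ifP => // _.
    by rewrite ler_pdivrMr// ler_peMr.
rewrite (_ : law P (n := n) = EFin \o (fun x => \prod_(i < n) g (tnth x i))%R); last first.
  by apply/funext => x; rewrite lawP.
apply: (divergence_ge (S := [set x | all [in e] x])) => //.
- by move=> x; exact: prodr_ge0.
- by rewrite (@esum_tuple_prod _ _ _ 1) ?expr1n// (esum_seq ue)// ge1.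
- by move=> x /negP/supp.
- by apply: qG => x /all_tnthP xe i; apply: eG; exact: xe.
Qed.

(** The function f + 1_{point} dominates the marginals of the class and has
    finite positive mass s + 1.  By independence its normalised n-fold product q
    satisfies P <= (s + 1)^n q for every source P of the class. *)
Lemma regret_lty (R : realType) (f : posnat -> R) n :
  (forall x, (0 <= f x)%R) -> \esum_(x in [set: posnat]) (f x)%:E < +oo ->
  minimax_regret n (envelope_class f) < +oo.
Proof.
move=> f0 foo.
have [s sE] : exists s, \esum_(x in [set: posnat]) (f x)%:E = s%:E.
  have : 0 <= \esum_(x in [set: posnat]) (f x)%:E.
    by apply: esum_ge0 => x _; rewrite lee_fin.
  by move: foo; case: esum => [s||]// _ _; exists s.
(* The extra unit mass makes the normalising constant s + 1 positive. *)
pose h x := (f x + (x == point)%:R)%R.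
have h0 x : (0 <= h x)%R by rewrite addr_ge0.
have hE : \esum_(x in [set: posnat]) (h x)%:E = (s + 1)%:E.
  rewrite (eq_esum (b := fun x => (f x)%:E + ((x == point)%:R)%:E))//.
  rewrite esumD ?sE; try by move=> x _; rewrite lee_fin.
  rewrite (@esum_seq _ _ [:: point])//; last by move=> x; rewrite inE => /negbTE ->.
  by rewrite big_seq1 eqxx.
have s0 : (0 < s + 1)%R.
  rewrite ltr_wpDl// -lee_fin -sE.
  by apply: esum_ge0 => x _; rewrite lee_fin.
pose q (x : n.-tuple posnat) := (\prod_(i < n) (h (tnth x i) / (s + 1)))%R.
have q0 x : (0 <= q x)%R by apply: prodr_ge0 => i _; rewrite divr_ge0// ltW.
have dq : distributions (EFin \o q).
  split=> [x|]; first by rewrite lee_fin.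
  rewrite (@esum_tuple_prod _ _ (fun x => h x / (s + 1))%R 1)//.
  - by rewrite expr1n.
  - by move=> x; rewrite divr_ge0// ltW.
  - rewrite (eq_esum (b := fun x => ((s + 1)^-1)%:E * (h x)%:E)) => [|x _].
      rewrite esumZl ?invr_ge0 ?(ltW s0)// hE.
      by rewrite -EFinM mulVf// gt_eqF.
    by rewrite -EFinM mulrC.
apply: (@le_lt_trans _ _ (ln ((s + 1) ^+ n) / ln 2)%:E); last exact: ltry.
apply: (@le_trans _ _ (ereal_sup
    [set ereal_sup [set log2 (law P x / (q x)%:E) | P in envelope_class f]
    | x in [set: n.-tuple posnat]])).
  by apply: ereal_inf_lbound; exists (EFin \o q).
apply: ge_ereal_sup => _ [x _ <-]; apply: ge_ereal_sup => _ [P [Pm _ Pf] <-].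
have lawE m (y : m.-tuple posnat) : law P y = (fine (law P y))%:E.
  by rewrite fineK// law_fin_num.
rewrite lawE; apply: log2_div_le => //; rewrite ?exprn_gt0// ?fine_ge0 ?law_ge0//.
rewrite (_ : (_ ^+ n * q x)%R = (\prod_(i < n) h (tnth x i))%R); last first.
  rewrite /q -[X in (_ ^+ X)%R]card_ord -prodr_const -big_split/=.
  by apply: eq_bigr => i _; rewrite mulrC divfK// gt_eqF.
rewrite -lee_fin -lawE law_memoryless//.
under eq_bigr do rewrite lawE.
rewrite prodEFin lee_fin; apply: ler_prod => i _.
rewrite fine_ge0 ?law_ge0//= -lee_fin -lawE (le_trans (Pf _))// lee_fin.
by rewrite lerDl.
Qed.

Theorem theorem3 (R : realType) (f : posnat -> R)
    (hf : forall x : posnat, (0 <= f x <= 1)%R) (n : nat) (hn : (0 < n)%N) :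
  minimax_redundancy n (envelope_class f) < +oo <->
  minimax_regret n (envelope_class f) < +oo.
Proof.
have bounded (z : \bar R) : z < +oo -> exists2 C : R, (0 <= C)%R & z <= C%:E.
  case: z => [r _||_]//; last by exists 0%R; rewrite ?leNye.
  by exists `|r|%R; rewrite ?normr_ge0// lee_fin ler_norm.
split=> [|/ereal_inf_lt[_ [q dq <-]] /bounded[C C0 qC]].
  have [foo _|] := ltP (\esum_(x in [set: posnat]) (f x)%:E) +oo.
    by apply: regret_lty => // x; case/andP: (hf x).
  rewrite leye_eq => /eqP foo /ereal_inf_lt[_ [q dq <-]] /bounded[C C0 qC].
  have ln20 : (0 < ln (2 : R))%R by rewrite ln_gt0// ltr1n.
  (* The constant is chosen so that log2 M = C + 1. *)
  have [|P Pf] := @divergence_unbounded _ f n q (expR ((C + 1) * ln 2)) hf foo hn dq.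
    by rewrite -[leLHS]expR0 ler_expR mulr_ge0 ?(ltW ln20)// addr_ge0.
  rewrite expRK mulfK ?gt_eqF// leNgt => /negP[].
  apply: (@le_lt_trans _ _ C%:E); last by rewrite lte_fin ltrDl.
  by apply: le_trans qC; apply: ereal_sup_ubound; exists P.
apply: (@le_lt_trans _ _ C%:E); last exact: ltry.
apply: (@le_trans _ _ (ereal_sup
    [set divergence (law P (n := n)) q | P in envelope_class f])).
  by apply: ereal_inf_lbound; exists q.
apply: ge_ereal_sup => _ [P Pf <-]; apply: divergence_le => // x.
apply: le_trans qC; apply: ereal_sup_ge; eexists; first by exists x.
by apply: ereal_sup_ubound; exists P.
Qed.
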